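(* Let $a_1,\dots,a_n$ be numbers and let $$\mathcal A_n=\begin{pmatrix}a_1&-a_1&0&\cdots&0\\0&a_2&-a_2&\cdots&0\\0&0&a_3&\cdots&0\\\vdots&\vdots&\vdots&\ddots&\vdots\\0&0&0&\cdots&a_n\end{pmatrix}$$ be the $n\times n$ matrix with $(i,i)$ entry $a_i$ for $1\le i\le n$, $(i,i+1)$ entry $-a_i$ for $1\le i\le n-1$, and all other entries zero. Then for every $k\in\mathbb N\cup\{0\}$ the power $k$ of $\mathcal A_n$ is $\mathcal A_n^k=(p_{sm})_{s,m=1}^n$ ($s$ the row index, $m$ the column index), where $$p_{sm}=\begin{cases}0&\text{if }m<s\text{ or }m>k+s,\\[2pt]a_s^k&\text{if }m=s,\\[2pt](-1)^{m-s}\,\mathscr H_{k-m+s}(a_s,a_{s+1},\dots,a_m)\,\displaystyle\prod_{i=s}^{m-1}a_i&\text{if }s<m\le k+s.\end{cases}$$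
   Context: The $a_i$ are real (or complex) numbers. $\mathscr H_q(x_1,\dots,x_r)$, $q=0,1,2,\dots$, is the complete homogeneous symmetric polynomial of degree $q$ in $r$ variables: $$\mathscr H_q(x_1,\dots,x_r)=\sum_{i_1+\dots+i_r=q,\ i_p\ge0}x_1^{i_1}x_2^{i_2}\cdots x_r^{i_r},$$ where a variable raised to the exponent $0$ is taken to be $1$. *)

(* Defs.v *)
From mathcomp Require Import all_boot all_order all_algebra.
Set Implicit Arguments.
Unset Strict Implicit.
Unset Printing Implicit Defensive.
Import GRing.Theory Num.Theory.
Local Open Scope ring_scope.

(* H_q(x_1, ..., x_r) for x = [:: x_1; ...; x_r], as the sum over all exponent
   vectors (i_1, ..., i_r) of total degree q; each exponent is at most q, so it
   is enough to let it range over 'I_q.+1. Note that 0 ^+ 0 = 1. *)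
Definition chsym (R : numFieldType) (q : nat) (x : seq R) : R :=
  \sum_(i : {ffun 'I_(size x) -> 'I_q.+1} | (\sum_p i p == q)%N)
    \prod_(p < size x) x`_p ^+ i p.

Definition bidiag_mx (R : numFieldType) (n : nat) (a : 'I_n -> R) : 'M[R]_n :=
  \matrix_(i < n, j < n)
    if j == i then a i else if (j == i.+1 :> nat) then - a i else 0.

(* The sequence a_s, a_(s+1), ..., a_m. *)
Definition slice (R : numFieldType) (n : nat) (a : 'I_n -> R) (s m : 'I_n) :
    seq R :=
  [seq a i | i : 'I_n <- enum 'I_n & (s <= i <= m)%N].

(* In the last branch m <= k + s, so the subtractions of naturals (k + s) - m
   and m - s are exact. Rows and columns are numbered from 0, which leaves all
   the conditions unchanged as they involve only differences of indices. *)
Definition bidiag_pow_entry (R : numFieldType) (n : nat) (a : 'I_n -> R)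
    (k : nat) (s m : 'I_n) : R :=
  if (m < s)%N || (k + s < m)%N then 0
  else if m == s then a s ^+ k
  else (-1) ^+ (m - s) * chsym (k + s - m) (slice a s m)
       * \prod_(i < n | (s <= i < m)%N) a i.

(* Main.v *)
(* The recursion [A ^+ k.+1 = A * A ^+ k] on entries is the identity
   [h_(q+1)(y, x) = y h_q(y, x) + h_(q+1)(x)] for complete homogeneous
   polynomials, multiplied by [+/- \prod a_i]. That identity is read off the
   generating series [\prod_y 1 / (1 - y 'X)]; truncating each geometric factor
   at degree [N] does not affect the coefficients below [N]. *)
Require Import Defs.
From mathcomp Require Import all_boot all_order all_algebra.
From mathcomp Require Import zify ring.
Set Implicit Arguments.
Unset Strict Implicit.
Unset Printing Implicit Defensive.
Import GRing.Theory Num.Theory.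
Local Open Scope ring_scope.

Definition geom_prod (R : numFieldType) (N : nat) (x : seq R) : {poly R} :=
  \prod_(y <- x) \sum_(j < N) (y ^+ j) *: 'X^j.

(** Distributing the product over the sums picks one exponent per factor, so the terms are indexed
    by the same finite functions as in [chsym]. Truncating at [q.+1] makes the exponent ranges agree
    exactly. *)
Lemma chsymE (R : numFieldType) (q : nat) (x : seq R) :
  chsym q x = (geom_prod q.+1 x)`_q.
Proof.
rewrite /geom_prod (big_nth 0) big_mkord bigA_distr_bigA coef_sum /=.
rewrite /chsym [LHS]big_mkcond; apply: eq_bigr => f _.
rewrite scaler_prod prodrXr coefZ coefXn eq_sym.
by case: eqP => _; rewrite ?mulr1 ?mulr0.
Qed.

(** Multiplying by [1 - y *: 'X] telescopes the factor of [y] to [1 - y ^+ N *: 'X^N], whose second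
    term only affects degrees at least [N]. *)
Lemma geom_prod_cons (R : numFieldType) (N q : nat) (y : R) (x : seq R) :
  (q < N)%N ->
  (geom_prod N (y :: x))`_q =
    (if q is q'.+1 then y * (geom_prod N (y :: x))`_q' else 0)
    + (geom_prod N x)`_q.
Proof.
move=> ltqN.
have geomE : (1 - y *: 'X) * geom_prod N (y :: x)
    = geom_prod N x - (y ^+ N) *: (geom_prod N x * 'X^N).
  rewrite /geom_prod big_cons mulrA; set G := \prod_(_ <- x) _.
  have -> : (1 - y *: 'X) * (\sum_(j < N) y ^+ j *: 'X^j) = 1 - y ^+ N *: 'X^N.
    under eq_bigr do rewrite -exprZn.
    by rewrite -[LHS]opprK -mulNr opprB -subrX1 opprB exprZn.
  by rewrite mulrBl mul1r -scalerAl ['X^N * G]mulrC.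
have /(congr1 (fun p : {poly R} => p`_q)) := geomE.
rewrite mulrBl mul1r -scalerAl !coefB !coefZ coefMXn ltqN mulr0 subr0 coefXM.
by move=> <-; case: (q) => [|q'] /=; rewrite ?mulr0 ?subr0 ?add0r // addrC subrK.
Qed.

(** Needed because [chsymE] ties the truncation to the degree, while the recursion compares
    different degrees. The recurrence of [geom_prod_cons] does not involve [N], so induction on [x],
    then on [q], suffices. *)
Lemma geom_prod_stable (R : numFieldType) (N M q : nat) (x : seq R) :
  (q < N)%N -> (q < M)%N -> (geom_prod N x)`_q = (geom_prod M x)`_q.
Proof.
elim: x q => [|y x IHx] q; first by rewrite /geom_prod !big_nil.
elim: q => [|q IHq] ltN ltM; rewrite (geom_prod_cons _ _ ltN) (geom_prod_cons _ _ ltM).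
  by rewrite (IHx 0).
by rewrite (IHx q.+1) // IHq // ltnW.
Qed.

Lemma chsym_cons (R : numFieldType) (q : nat) (y : R) (x : seq R) :
  chsym q.+1 (y :: x) = y * chsym q (y :: x) + chsym q.+1 x.
Proof.
rewrite !chsymE geom_prod_cons //; congr (_ * _ + _).
exact: geom_prod_stable.
Qed.

Lemma chsym0 (R : numFieldType) (x : seq R) : chsym 0 x = 1.
Proof.
rewrite chsymE; elim: x => [|y x IHx].
  by rewrite /geom_prod big_nil coef1.
by rewrite geom_prod_cons // add0r.
Qed.

Lemma chsymS_nil (R : numFieldType) (q : nat) : chsym q.+1 ([::] : seq R) = 0.
Proof. by rewrite chsymE /geom_prod big_nil coef1. Qed.

Lemma chsym_seq1 (R : numFieldType) (q : nat) (y : R) :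
  chsym q [:: y] = y ^+ q.
Proof.
elim: q => [|q IHq]; first exact: chsym0.
by rewrite chsym_cons chsymS_nil addr0 IHq exprS.
Qed.

(** Before applying [a], both index lists are strictly increasing and have the same members, hence
    are equal. *)
Lemma slice_cons (R : numFieldType) (n : nat) (a : 'I_n -> R) (s m : 'I_n) :
  (s <= m)%N ->
  slice a s m = a s :: [seq a i | i : 'I_n <- enum 'I_n & (s < i <= m)%N].
Proof.
move=> lesm; rewrite /slice -map_cons; congr map.
have ltT : transitive (fun i j : 'I_n => (i < j)%N) by move=> ? ? ?; apply: ltn_trans.
have enum_sorted : sorted (fun i j : 'I_n => (i < j)%N) (enum 'I_n).
  by have := iota_ltn_sorted 0 n; rewrite -val_enum_ord sorted_map.
apply: (irr_sorted_eq ltT) => [i||| i]; first exact: ltnn.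
- exact: sorted_filter.
- rewrite /= path_min_sorted; first exact: sorted_filter.
  by apply/allP => i; rewrite mem_filter => /andP[/andP[]].
- rewrite inE mem_filter [X in _ || X]mem_filter mem_enum !andbT -val_eqE /=; lia.
Qed.

Lemma slice_id (R : numFieldType) (n : nat) (a : 'I_n -> R) (s : 'I_n) :
  slice a s s = [:: a s].
Proof.
rewrite slice_cons // (@eq_filter _ _ pred0) ?filter_pred0 // => i /=; lia.
Qed.

Lemma slice_rec (R : numFieldType) (n : nat) (a : 'I_n -> R) (s t m : 'I_n) :
  t = s.+1 :> nat -> (s < m)%N -> slice a s m = a s :: slice a t m.
Proof. by move=> tE ltsm; rewrite slice_cons ?(ltnW ltsm) // /slice tE. Qed.

(** The diagonal case fits the general formula: the product is empty and [chsym k [:: a s]] is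
    [a s ^+ k]. This spares a separate treatment of [m = t] in the recursion below. *)
Lemma bidiag_pow_entryE (R : numFieldType) (n : nat) (a : 'I_n -> R)
    (k : nat) (s m : 'I_n) :
  bidiag_pow_entry a k s m =
    if (s <= m <= k + s)%N then
      (-1) ^+ (m - s) * chsym (k + s - m) (slice a s m)
      * \prod_(i < n | (s <= i < m)%N) a i
    else 0.
Proof.
rewrite /bidiag_pow_entry.
have -> : (s <= m <= k + s)%N = ~~ ((m < s)%N || (k + s < m)%N) by lia.
case: ifP => //= _; case: eqP => // ->.
rewrite subnn addnK slice_id chsym_seq1 big_pred0 ?mulr1 ?mul1r // => i; lia.
Qed.

(** Row [s] of the matrix has only the entries [a s] in column [s] and [- a s] in column [t]. *)
Lemma bidiag_pow_entryS (R : numFieldType) (n : nat) (a : 'I_n -> R)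
    (k : nat) (s t m : 'I_n) :
  t = s.+1 :> nat ->
  bidiag_pow_entry a k.+1 s m =
    a s * (bidiag_pow_entry a k s m - bidiag_pow_entry a k t m).
Proof.
move=> tE; case: (ltngtP s m) => [ltsm | ltms | /val_inj eqsm].
- rewrite !bidiag_pow_entryE.
  have -> : \prod_(i < n | (s <= i < m)%N) a i
      = a s * \prod_(i < n | (t <= i < m)%N) a i.
    rewrite (bigD1 s) /=; last by lia.
    by congr (_ * _); apply: eq_bigl => i; rewrite -val_eqE /=; lia.
  have -> : (m - s = (m - t).+1)%N by lia.
  have -> : (k + t - m = k.+1 + s - m)%N by lia.
  have -> : (s <= m <= k.+1 + s)%N = (m <= k.+1 + s)%N by lia.
  have -> : (s <= m <= k + s)%N = (m <= k + s)%N by lia.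
  have -> : (t <= m <= k + t)%N = (m <= k.+1 + s)%N by lia.
  rewrite (slice_rec a tE ltsm) exprS.
  (* Inside the band this is [chsym_cons], the minus sign being absorbed by the change from [m - s]
     to [m - t]. *)
  case: (leqP m (k + s)) => lemk.
    have -> : (m <= k.+1 + s)%N by lia.
    have -> : (k.+1 + s - m = (k + s - m).+1)%N by lia.
    by rewrite chsym_cons; ring.
  (* On the new outermost diagonal [m = k.+1 + s], the entry at [s] for exponent [k] vanishes and
     both remaining [chsym] have degree 0. *)
  case: ifP => lemkS; last by ring.
  have -> : (k.+1 + s - m = 0)%N by lia.
  by rewrite !chsym0; ring.
- by rewrite /bidiag_pow_entry tE ltms (ltnW ltms : (m < s.+1)%N) subrr mulr0.
- by rewrite -eqsm /bidiag_pow_entry tE ltnn ltnSn eqxx !ltnNge !leq_addl subr0 exprS.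
Qed.

Lemma bidiag_pow_entryS_last (R : numFieldType) (n : nat) (a : 'I_n -> R)
    (k : nat) (s m : 'I_n) :
  n = s.+1 -> bidiag_pow_entry a k.+1 s m = a s * bidiag_pow_entry a k s m.
Proof.
move=> nE; rewrite /bidiag_pow_entry.
case: (ltngtP m s) => [ltms | | /val_inj ->]; first by rewrite mulr0.
  by have := ltn_ord m; lia.
by rewrite eqxx !ltnNge !leq_addl exprS.
Qed.

Theorem theorem1 (R : numFieldType) (n : nat) (a : 'I_n -> R) (k : nat) :
  bidiag_mx a ^+ k = \matrix_(s < n, m < n) bidiag_pow_entry a k s m.
Proof.
elim: k => [|k IHk]; apply/matrixP => s m.
  (* For [k = 0] the band condition excludes everything but the diagonal, which leaves the identity
     matrix. *)
  rewrite expr0 !mxE /bidiag_pow_entry add0n -neq_ltn val_eqE.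
  by case: (eqVneq m s).
rewrite exprS IHk -mulmxE !mxE (bigD1 s) //= !mxE eqxx.
(* The last row has no superdiagonal entry, so only its diagonal term survives. *)
case: (ltnP s.+1 n) => [ltsn | lens].
  pose t := Ordinal ltsn.
  rewrite (bigD1 t) /=; last by rewrite -val_eqE /=; lia.
  rewrite big1 => [|j /andP[neqjs neqjt]].
    rewrite !mxE -val_eqE /= eqxx (gtn_eqF (ltnSn s)).
    by rewrite (@bidiag_pow_entryS _ _ _ _ _ t) //; ring.
  rewrite !mxE (negPf neqjs); move: neqjt; rewrite -val_eqE /= => /negPf ->.
  by rewrite mul0r.
rewrite big1 => [|j neqjs].
  by rewrite addr0 bidiag_pow_entryS_last //; have := ltn_ord s; lia.
rewrite !mxE (negPf neqjs); case: eqP => [|_]; last by rewrite mul0r.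
by have := ltn_ord j; lia.
Qed.
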